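(* Let $d$ be a positive integer and let $\mathcal{F}:\mathcal{P}(\mathbb{S}^{d-1})\to\mathbb{R}^{d\times d}$ be such that there is a constant $L_{\mathcal{F}}\ge 0$ with $\|\mathcal{F}[\varrho]-\mathcal{F}[\widetilde\varrho]\|_{\mathrm{op}}\le L_{\mathcal{F}}W_1(\varrho,\widetilde\varrho)$ for all $\varrho,\widetilde\varrho\in\mathcal{P}(\mathbb{S}^{d-1})$. Then, for every $n\in\mathbb{N}$ and every initial configuration $(x_{1,0},\dots,x_{n,0})\in(\mathbb{S}^{d-1})^n$, the system $$\dot{x}_k(t)=\left(I_d-x_k(t)x_k(t)^{\top}\right)\mathcal{F}[\rho_n(t)]\,x_k(t),\qquad x_k(0)=x_{k,0},\qquad k=1,\dots,n,$$ where $\rho_n(t):=\frac1n\sum_{k=1}^n\delta_{x_k(t)}$, admits a unique global solution $(x_1,\dots,x_n)\in C^1([0,\infty);(\mathbb{S}^{d-1})^n)$.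
   Context: $\mathbb{S}^{d-1}$ is the unit sphere in $\mathbb{R}^d$ with the Euclidean norm $\|\cdot\|$; $\|\cdot\|_{\mathrm{op}}$ is the matrix operator norm; $\mathcal{P}(\mathbb{S}^{d-1})$ is the set of (Borel) probability measures on $\mathbb{S}^{d-1}$, equipped with the Wasserstein-1 distance $W_1$ induced by the Euclidean distance. $\delta_x$ is the Dirac mass at $x$. *)

(* Defs.v *)
From HB Require Import structures.
From mathcomp Require Import all_boot all_order all_algebra.
From mathcomp Require Import all_classical all_reals all_analysis.
Set Implicit Arguments.
Unset Strict Implicit.
Unset Printing Implicit Defensive.
Import Order.TTheory GRing.Theory Num.Theory.
Import numFieldNormedType.Exports.
Local Open Scope classical_set_scope.
Local Open Scope ring_scope.

(* The library norm `|_| on matrices is the sup norm, hence the next two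
   definitions; the topology it induces is the Euclidean one. *)
Definition enorm (R : realType) (d : nat) (x : 'cV[R]_d) : R :=
  Num.sqrt (\sum_(i < d) x i ord0 ^+ 2).

Definition opnorm (R : realType) (d : nat) (A : 'M[R]_d) : R :=
  sup [set enorm (A *m x) | x in [set x : 'cV[R]_d | enorm x <= 1]].

Record sphere (R : realType) (d : nat) := Sphere {
  sphere_val :> 'cV[R]_d ;
  sphere_valP : enorm sphere_val == 1 }.

HB.instance Definition _ (R : realType) (d : nat) :=
  [isSub for @sphere_val R d].
HB.instance Definition _ (R : realType) (d : nat) :=
  [Choice of sphere R d by <:].

HB.instance Definition _ (R : realType) (d : nat) :=
  Topological.copy (sphere R d) (initial_topology (@sphere_val R d)).

Lemma enorm_delta (R : realType) (d : nat) :
  enorm (delta_mx ord0 ord0 : 'cV[R]_d.+1) == 1.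
Proof.
rewrite /enorm (bigD1 ord0) //= big1 => [|i /negPf i0].
  by rewrite mxE !eqxx expr1n addr0 sqrtr1.
by rewrite mxE i0 expr0n.
Qed.

(* Measurable types are pointed, so the Borel structure is only put on the
   (nonempty) spheres of R^d.+1. *)
HB.instance Definition _ (R : realType) (d : nat) :=
  isPointed.Build (sphere R d.+1) (Sphere (enorm_delta R d)).

HB.instance Definition _ (R : realType) (d : nat) :=
  Measurable.copy (sphere R d.+1)
    (g_sigma_algebraType (@open (sphere R d.+1))).

Definition is_coupling (R : realType) (d : nat)
    (mu nu : probability (sphere R d.+1) R)
    (pi : probability (sphere R d.+1 * sphere R d.+1)%type R) : Prop :=
  forall A : set (sphere R d.+1), measurable A ->
    pi (A `*` setT) = mu A /\ pi (setT `*` A) = nu A.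

Definition W1 (R : realType) (d : nat)
    (mu nu : probability (sphere R d.+1) R) : \bar R :=
  ereal_inf [set (\int[pi]_z (enorm (sphere_val z.1 - sphere_val z.2))%:E)%E
            | pi in [set pi | is_coupling mu nu pi]].

Definition empirical (R : realType) (d n : nat)
    (x : 'I_n.+1 -> sphere R d.+1) (A : set (sphere R d.+1)) : \bar R :=
  ((n.+1%:R^-1)%:E * \sum_(k < n.+1) \d_(x k) A)%E.

Section empirical_probability.
Variables (R : realType) (d n : nat) (x : 'I_n.+1 -> sphere R d.+1).

Let empiricalE : empirical x =
  mscale (n.+1%:R^-1)%:nng (msum (fun k => \d_(x (inord k))) n.+1).
Proof.
apply/funext => A; rewrite /empirical /mscale /msum /=.
by congr (_ * _)%E; apply: eq_bigr => k _; rewrite inord_val.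
Qed.

Let empirical0 : empirical x set0 = 0%E.
Proof. by rewrite empiricalE measure0. Qed.

Let empirical_ge0 A : (0 <= empirical x A)%E.
Proof. by rewrite empiricalE measure_ge0. Qed.

Let empirical_sigma_additive : semi_sigma_additive (empirical x).
Proof. by rewrite empiricalE; exact: measure_semi_sigma_additive. Qed.

HB.instance Definition _ := isMeasure.Build _ _ _ (empirical x)
  empirical0 empirical_ge0 empirical_sigma_additive.

Let empirical_setT : empirical x setT = 1%E.
Proof.
rewrite /empirical (eq_bigr (fun=> 1%E)) => [|k _]; last exact: diracT.
by rewrite sumEFin sumr_const card_ord -EFinM mulVf.
Qed.

HB.instance Definition _ :=
  Measure_isProbability.Build _ _ _ (empirical x) empirical_setT.

End empirical_probability.

(* f' is the derivative of f on [0, +oo[, one-sided at 0; the values of f and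
   f' at negative times are irrelevant. *)
Definition is_deriv_ge0 (R : realType) (V : normedModType R) (f f' : R -> V)
    : Prop :=
  (forall t : R, 0 < t -> is_derive t (1 : R) f (f' t)) /\
  h^-1 *: (f h - f 0) @[h --> 0^'+] --> f' 0.

Definition C1_ge0 (R : realType) (V : normedModType R) (f : R -> V) : Prop :=
  exists2 f' : R -> V,
    is_deriv_ge0 f f' & {within `[0, +oo[%classic, continuous f'}.

Definition is_global_solution (R : realType) (d n : nat)
    (F : probability (sphere R d.+1) R -> 'M[R]_d.+1)
    (x0 : 'I_n.+1 -> sphere R d.+1)
    (x : 'I_n.+1 -> R -> sphere R d.+1) : Prop :=
  [/\ forall k, C1_ge0 (fun t => sphere_val (x k t)),
      forall k, x k 0 = x0 k
    & forall k, is_deriv_ge0 (fun t => sphere_val (x k t))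
        (fun t => (1%:M - sphere_val (x k t) *m (sphere_val (x k t))^T)
                    *m F (empirical (x^~ t)) *m sphere_val (x k t))].

(* Main.v *)
(* The n particles are the rows of a matrix X.  Matching x_k with y_k couples
   two empirical measures, so W_1 is at most the mean distance between the
   particles, and the entries of F[rho_n] are Lipschitz functions of the
   configuration.  McShane's formula extends them to all matrices, and after
   radially rescaling every row by 1 / max(1, |x_k|) the right-hand side becomes
   bounded and globally Lipschitz, so Picard iteration, convergent for the
   weight exp(2Kt), gives a solution for all t >= 0.  The extended field stays
   tangent to the unit sphere up to a defect O(| |x_k|^2 - 1 |), so Gronwall's
   lemma applied to (|x_k|^2 - 1)^2 keeps the solution on the sphere, where the
   extended and the original systems agree.  Uniqueness is Gronwall's lemma for
   the squared distance of two solutions. *)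
From HB Require Import structures.
Require Import Defs.
From mathcomp Require Import all_boot all_order all_algebra.
From mathcomp Require Import all_classical all_reals all_analysis.
From mathcomp Require Import measurable_realfun ring lra.
Set Implicit Arguments.
Unset Strict Implicit.
Unset Printing Implicit Defensive.
Import Order.TTheory GRing.Theory Num.Theory.
Import numFieldNormedType.Exports.
Local Open Scope classical_set_scope.
Local Open Scope ring_scope.

(** * Real functions and antiderivatives *)

Lemma mx_norm_leP (R : realType) (m n : nat) (X : 'M[R]_(m, n)) (e : R) :
  0 <= e -> `|X| <= e <-> forall i j, `|X i j| <= e.
Proof.
move=> e0; rewrite /Num.Def.normr/= mx_normrE; split.
  by move/bigmax_leP => [_ h] i j; exact: (h (i, j)).
by move=> h; apply/bigmax_leP; split => // -[i j] _; exact: h.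
Qed.

Lemma ler_coord_norm (R : realType) (m n : nat) (X : 'M[R]_(m, n)) i j :
  `|X i j| <= `|X|.
Proof. by move: i j; apply/mx_norm_leP. Qed.

Lemma continuous_mx (R : realType) (T : topologicalType) (m n : nat)
    (X : T -> 'M[R]_(m, n)) (t : T) :
  (forall i j, {for t, continuous (fun s => X s i j)}) ->
  {for t, continuous X}.
Proof.
move=> cX; apply/cvgrPdist_le => e e0; near=> s.
apply/mx_norm_leP; first exact: ltW.
suff : forall i j, `|X t i j - X s i j| <= e by move=> h i j; rewrite !mxE.
near: s.
apply: filter_forall => i; apply: filter_forall => j.
by move/cvgrPdist_le : (cX i j) => /(_ e e0).
Unshelve. all: by end_near. Qed.

(** The mean value theorem applied to [g - f] and [g + f], whose derivatives are nonnegative. It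
    stands in for bounding an integral by the integral of a majorant, and asks for nothing at 0
    beyond continuity. *)
Lemma ler_dist_derive (R : realType) (f g df dg : R -> R) (t : R) : 0 <= t ->
  (forall s : R, 0 < s -> is_derive s 1 f (df s)) ->
  (forall s : R, 0 < s -> is_derive s 1 g (dg s)) ->
  {within `[0, t], continuous f} -> {within `[0, t], continuous g} ->
  (forall s : R, 0 < s -> `|df s| <= dg s) ->
  `|f t - f 0| <= g t - g 0.
Proof.
rewrite le_eqVlt => /predU1P[<- *|t0 hf hg cf cg fg].
  by rewrite !subrr normr0.
have [c] : exists2 c, c \in `]0, t[%R &
    (g - f) t - (g - f) 0 = (dg c - df c) * (t - 0).
  apply: (@MVT _ _ (fun s => dg s - df s)) => //.
    move=> s; rewrite in_itv/= => /andP[s0 _].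
    have := hf s s0; have := hg s s0 => *; exact: is_deriveB.
  by move=> s; apply: continuousD; [exact: cg|exact/continuousN/cf].
rewrite in_itv/= => /andP[c0 _]; rewrite !fctE => e1.
have [b] : exists2 c, c \in `]0, t[%R &
    (g + f) t - (g + f) 0 = (dg c + df c) * (t - 0).
  apply: (@MVT _ _ (fun s => dg s + df s)) => //.
    move=> s; rewrite in_itv/= => /andP[s0 _].
    have := hf s s0; have := hg s s0 => *; exact: is_deriveD.
  by move=> s; apply: continuousD; [exact: cg|exact: cf].
rewrite in_itv/= => /andP[b0 _]; rewrite !fctE => e2.
have /ler_normlP[p1 p2] := fg c c0; have /ler_normlP[q1 q2] := fg b b0.
have : 0 <= (dg c - df c) * (t - 0) by apply: mulr_ge0; lra.
have : 0 <= (dg b + df b) * (t - 0) by apply: mulr_ge0; lra.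
rewrite -e1 -e2 => h1 h2.
by apply/ler_normlP; split; lra.
Qed.

Lemma is_derive_expRM (R : realType) (K t : R) :
  is_derive t 1 (fun s => expR (K * s)) (K * expR (K * t)).
Proof.
have h : is_derive t 1 (fun s : R => K * s) K.
  by apply: is_derive_eq; rewrite /GRing.scale/= ?(mulr1, mulr0, addr0, mul0r).
have := @is_derive1_comp _ expR (fun s : R => K * s) t _ _ (is_derive_expR _) h.
by rewrite mulrC.
Qed.

(* [phi] times [expR (- K t)] is nonincreasing. *)
Lemma gronwall0 (R : realType) (phi dphi : R -> R) (K t : R) : 0 <= t ->
  (forall s : R, 0 < s -> is_derive s 1 phi (dphi s)) ->
  {within `[0, t], continuous phi} ->
  (forall s : R, 0 < s -> dphi s <= K * phi s) ->
  phi 0 = 0 -> phi t <= 0.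
Proof.
rewrite le_eqVlt => /predU1P[<- *|t0 hphi cphi le_phi phi0]; first lra.
have [c] : exists2 c, c \in `]0, t[%R &
    (phi * (fun s => expR (- K * s))) t - (phi * (fun s => expR (- K * s))) 0
     = (phi c * (- K * expR (- K * c)) + expR (- K * c) * dphi c) * (t - 0).
  apply: (@MVT _ _ (fun s => phi s * (- K * expR (- K * s))
                             + expR (- K * s) * dphi s)) => //.
    move=> s; rewrite in_itv/= => /andP[s0 _].
    have h1 := hphi s s0; have h2 := is_derive_expRM (- K) s.
    exact: is_deriveM.
  move=> s; apply: continuousM; first exact: cphi.
  apply: continuous_subspaceT => {}s.
  apply: differentiable_continuous; apply/derivable1_diffP.
  by have [] := is_derive_expRM (- K) s.
rewrite in_itv/= => /andP[c0 _]; rewrite !fctE phi0 mul0r !subr0 => e.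
suff : phi t * expR (- K * t) <= 0 by rewrite pmulr_lle0// expR_gt0.
rewrite e; have -> : (phi c * (- K * expR (- K * c)) + expR (- K * c) * dphi c) * t
    = - (expR (- K * c) * t * (K * phi c - dphi c)) by ring.
rewrite oppr_le0; apply: mulr_ge0; first by rewrite mulr_ge0 ?expR_ge0 ?ltW.
by rewrite subr_ge0 le_phi.
Qed.

(* Integrating from -1 makes 0 an interior point, so that the derivative there is
   two-sided. *)
Definition primitive (R : realType) (f : R -> R) (t : R) : R :=
  (\int[@lebesgue_measure R]_(s in `[(-1)%R, t]) f s)%R
  - (\int[@lebesgue_measure R]_(s in `[(-1)%R, 0%R]) f s)%R.

Lemma primitive0 (R : realType) (f : R -> R) : primitive f 0 = 0.
Proof. exact: subrr. Qed.

Lemma is_derive_primitive (R : realType) (f : R -> R) (t : R) :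
  continuous f -> 0 <= t -> is_derive t 1 (primitive f) (f t).
Proof.
move=> cf t0.
have [] := @continuous_FTC1_closed R f (-1) t (t + 1).
- by rewrite ltrDl.
- apply: continuous_compact_integrable; first exact: segment_compact.
  exact: continuous_subspaceT.
- by apply: lt_le_trans t0; rewrite oppr_lt0.
- exact: cf.
move=> d1 d2; rewrite derive1E in d2.
have h := derivableP d1; rewrite d2 in h.
have : is_derive t 1
    ((fun y => (\int[@lebesgue_measure R]_(t in `[(-1)%R, y]) f t)%R)
      - cst (\int[@lebesgue_measure R]_(s in `[(-1)%R, 0%R]) f s)%R) (f t - 0).
  exact: is_deriveB.
by rewrite subr0.
Qed.

(** * Picard-Lindelof for a globally Lipschitz field *)

(** With [b m = 2 * C / 2 ^+ m], the drop [b m - b m.+1] is exactly the allowed increment, so the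
    intervals of radius [b m] around [u m] are nested. The supremum of their left endpoints lies in
    all of them. *)
Lemma geometric_dist_limit (R : realType) (u : nat -> R) (C : R) :
  (forall m, `|u m.+1 - u m| <= C / 2 ^+ m) ->
  exists l, forall m, `|l - u m| <= 2 * C / 2 ^+ m.
Proof.
move=> hu.
have C0 : 0 <= C by have := hu 0%N; rewrite expr0 divr1; apply: le_trans.
pose b m := 2 * C / 2 ^+ m.
have b0 m : 0 <= b m by rewrite /b divr_ge0 ?exprn_ge0 // mulr_ge0.
have bS m : b m - b m.+1 = C / 2 ^+ m.
  rewrite /b exprS; field.
  by rewrite expf_neq0.
have inc k m : u m - b m <= u (m + k)%N - b (m + k)%N.
  elim: k => [|k ih]; first by rewrite addn0.
  apply: le_trans ih _; rewrite addnS.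
  have := hu (m + k)%N; rewrite -bS => /ler_normlP[]; lra.
have dec k m : u (m + k)%N + b (m + k)%N <= u m + b m.
  elim: k => [|k]; first by rewrite addn0.
  apply: le_trans; rewrite addnS.
  have := hu (m + k)%N; rewrite -bS => /ler_normlP[]; lra.
have ub m k : u m - b m <= u k + b k.
  have := inc k m; have := dec m k; rewrite addnC; have := b0 (m + k)%N; lra.
pose S := range (fun m => u m - b m).
have S0 : S !=set0 by exists (u 0%N - b 0%N), 0%N.
have uS k : ubound S (u k + b k) by move=> _ [m _ <-]; exact: ub.
exists (sup S) => m; apply/ler_normlP; split.
  suff : u m - b m <= sup S by rewrite /b; lra.
  by apply: ub_le_sup; [exists (u 0%N + b 0%N)|exists m].
suff : sup S <= u m + b m by rewrite /b; lra.
exact: ge_sup.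
Qed.

Lemma geometric_small (R : realType) (C e : R) : 0 < e ->
  exists k, C / 2 ^+ k < e.
Proof.
(* The Archimedean bound of a number is also an exponent at which the power of 2 exceeds that
   number. *)
move=> e0; exists (Num.bound (C / e)).
rewrite ltr_pdivrMr ?exprn_gt0 // mulrC -ltr_pdivrMr //.
exact: upper_nthrootP.
Qed.

Section picard.
Variables (R : realType) (m n : nat) (G : 'M[R]_(m, n) -> 'M[R]_(m, n)).
Variables (K : R) (X0 : 'M[R]_(m, n)).
Hypothesis K1 : 1 <= K.
Hypothesis G_lip : forall X Y, `|G X - G Y| <= K * `|X - Y|.

Let K0 : 0 < K. Proof. exact: lt_le_trans K1. Qed.

Lemma lipschitz_mx_continuous : continuous G.
Proof.
move=> X; apply/(@cvgrPdist_le _ _ _ (nbhs X)) => e e0; near=> Y.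
apply: le_trans (G_lip _ _) _.
rewrite mulrC -ler_pdivlMr //; near: Y.
apply/nbhs_ballP; exists (e / K); first by rewrite /= divr_gt0.
by move=> Y; rewrite mx_norm_ball /ball_ /= => /ltW.
Unshelve. all: by end_near. Qed.

(** The Picard integral operator, written entry by entry because [primitive] acts on real
    functions. *)
Definition solve_along (X : R -> 'M[R]_(m, n)) (t : R) : 'M[R]_(m, n) :=
  \matrix_(i, j) (X0 i j + primitive (fun s => G (X s) i j) t).

(* Freezing the argument at [`|t|] keeps the iterates defined and continuous on
   the whole line while only integrals over [0, +oo[ are used. *)
Fixpoint picard_iter (k : nat) : R -> 'M[R]_(m, n) :=
  if k is k'.+1 then fun t => solve_along (picard_iter k') `|t|
  else fun=> X0.

Lemma continuous_coord_field (X : R -> 'M[R]_(m, n)) i j :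
  continuous X -> continuous (fun s => G (X s) i j).
Proof.
move=> cX s.
apply: (@continuous_comp _ _ _ (G \o X) (fun M : 'M[R]_(m, n) => M i j)).
  by apply: continuous_comp; [exact: cX|exact: lipschitz_mx_continuous].
exact: coord_continuous.
Qed.

Lemma is_derive_solve_along (X : R -> 'M[R]_(m, n)) (t : R) i j :
  continuous X -> 0 <= t ->
  is_derive t 1 (fun s => solve_along X s i j) (G (X t) i j).
Proof.
move=> cX t0.
have h := is_derive_primitive (continuous_coord_field (i:=i) (j:=j) cX) t0.
have -> : (fun s => solve_along X s i j) =
    cst (X0 i j) + primitive (fun s => G (X s) i j).
  by apply/funext => s; rewrite mxE.
by rewrite -[G (X t) i j]add0r; exact: is_deriveD.
Qed.

Lemma continuous_solve_along (X : R -> 'M[R]_(m, n)) (t : R) :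
  continuous X -> 0 <= t -> {for t, continuous (solve_along X)}.
Proof.
move=> cX t0; apply: continuous_mx => i j.
apply: differentiable_continuous; apply/derivable1_diffP.
by have [] := is_derive_solve_along i j cX t0.
Qed.

Lemma within_continuous_solve_along (X : R -> 'M[R]_(m, n)) (t : R) i j :
  continuous X -> {within `[0, t], continuous (fun s => solve_along X s i j)}.
Proof.
move=> cX; apply: derivable_within_continuous => s.
by rewrite in_itv/= => /andP[s0 _]; have [] := is_derive_solve_along i j cX s0.
Qed.

Lemma solve_along0 (X : R -> 'M[R]_(m, n)) : solve_along X 0 = X0.
Proof. by apply/matrixP => i j; rewrite mxE primitive0 addr0. Qed.

Lemma continuous_picard_iter k : continuous (picard_iter k).
Proof.
elim: k => [|k ih] t /=; first exact: cvg_cst.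
apply: (@continuous_comp _ _ _ (fun t : R => `|t|)
  (solve_along (picard_iter k))).
  exact: norm_continuous.
exact: continuous_solve_along.
Qed.

Lemma within_continuous_weight (C t : R) :
  {within `[0, t], continuous (fun s : R => C * expR (2 * K * s))}.
Proof.
apply: derivable_within_continuous => s _.
by apply: derivableM => //; have [] := is_derive_expRM (2 * K) s.
Qed.

Lemma is_derive_weight (C t : R) :
  is_derive t 1 (fun s : R => C * expR (2 * K * s))
    (2 * K * (C * expR (2 * K * t))).
Proof.
have h := is_derive_expRM (2 * K) t.
rewrite (_ : 2 * K * _ = C *: (2 * K * expR (2 * K * t))).
  exact: is_deriveZ.
by rewrite /GRing.scale/=; ring.
Qed.

(** The Picard operator halves distances in the sup norm weighted by [expR (2 * K * t)]: the
    derivatives differ by at most [K * (C * expR (2 * K * s))], which is the derivative of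
    [C / 2 * expR (2 * K * s)]. *)
Lemma solve_along_dist (X Y : R -> 'M[R]_(m, n)) (C t : R) :
  continuous X -> continuous Y -> 0 <= C -> 0 <= t ->
  (forall s : R, 0 <= s -> `|X s - Y s| <= C * expR (2 * K * s)) ->
  `|solve_along X t - solve_along Y t| <= C / 2 * expR (2 * K * t).
Proof.
move=> cX cY C0 t0 XY; apply/mx_norm_leP.
  by rewrite mulr_ge0 ?expR_ge0 // divr_ge0.
move=> i j.
pose f (s : R) := solve_along X s i j - solve_along Y s i j.
pose df (s : R) := G (X s) i j - G (Y s) i j.
pose g (s : R) := C / 2 * expR (2 * K * s).
have : `|f t - f 0| <= g t - g 0.
  apply: (ler_dist_derive (df := df) (dg := fun s => 2 * K * g s)) => //.
  - move=> s /ltW s0; have h1 := is_derive_solve_along i j cX s0.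
    have h2 := is_derive_solve_along i j cY s0.
    exact: is_deriveB.
  - by move=> s _; exact: is_derive_weight.
  - move=> s.
    have hX := within_continuous_solve_along (t := t) (i := i) (j := j) cX.
    have hY := within_continuous_solve_along (t := t) (i := i) (j := j) cY.
    exact: (continuousD (hX s) (continuousN (hY s))).
  - exact: within_continuous_weight.
  - move=> s /ltW s0; rewrite /df.
    have := ler_coord_norm (G (X s) - G (Y s)) i j; rewrite !mxE => h.
    apply: le_trans h _; apply: le_trans (G_lip _ _) _.
    have -> : 2 * K * g s = K * (C * expR (2 * K * s)) by rewrite /g; field.
    by rewrite ler_pM2l // XY.
rewrite /f !solve_along0 subrr subr0 !mxE => h; apply: le_trans h _.
by rewrite /g gerBl mulr_ge0 ?expR_ge0 // divr_ge0.
Qed.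

Lemma picard_iter_dist k (t : R) :
  `|picard_iter k.+1 t - picard_iter k t|
    <= `|G X0| * expR (2 * K * `|t|) / 2 ^+ k.
Proof.
(* Every iterate depends on [t] through [|t|] only. *)
suff h : forall t : R, 0 <= t ->
    `|solve_along (picard_iter k) t - picard_iter k t|
    <= `|G X0| / 2 ^+ k * expR (2 * K * t).
  rewrite mulrAC; have -> : picard_iter k t = picard_iter k `|t|.
    by case: k {h} => //= k; rewrite normr_id.
  exact: h.
elim: k => [|k ih] {}t t0.
  rewrite expr0 divr1; apply/mx_norm_leP.
    by rewrite mulr_ge0 ?expR_ge0.
  move=> i j; rewrite !mxE.
  pose g (s : R) := `|G X0| * expR (2 * K * s).
  have : `|solve_along (fun=> X0) t i j - solve_along (fun=> X0) 0 i j|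
      <= g t - g 0.
    apply: (ler_dist_derive (f := fun s => solve_along (fun=> X0) s i j)
      (df := fun=> G X0 i j) (dg := fun s => 2 * K * g s)) => //.
    - move=> s /ltW s0; apply: (is_derive_solve_along (X := fun=> X0)) => //.
      by move=> ?; exact: cvg_cst.
    - by move=> s _; exact: is_derive_weight.
    - apply: within_continuous_solve_along.
      by move=> ?; exact: cvg_cst.
    - exact: within_continuous_weight.
    - move=> s s0; apply: le_trans (ler_coord_norm _ _ _) _.
      rewrite /g mulrCA ler_peMr //.
      (* The bound [1 <= K] lets the derivative of the weight dominate the constant derivative of
         the first iterate. *)
      have e1 : 1 <= expR (2 * K * s).
        by rewrite -expR0 ler_expR mulr_ge0 ?mulr_ge0 // ltW.
      have := K1; nra.
  rewrite solve_along0 mxE => h; apply: le_trans h _.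
  by rewrite /g gerBl mulr_ge0 ?expR_ge0.
rewrite /= ger0_norm //.
have -> : `|G X0| / 2 ^+ k.+1 = `|G X0| / 2 ^+ k / 2.
  by rewrite exprS; field; rewrite expf_neq0.
apply: (solve_along_dist (X := picard_iter k.+1)) t0 _.
- exact: (@continuous_picard_iter k.+1).
- exact: (@continuous_picard_iter k).
- by rewrite divr_ge0 // exprn_ge0.
- by move=> s s0 /=; rewrite ger0_norm //; exact: ih.
Qed.

End picard.

Section picard_solution.
Variables (R : realType) (m n : nat) (G : 'M[R]_(m, n) -> 'M[R]_(m, n)).
Variables (K : R) (X0 : 'M[R]_(m, n)).
Hypothesis K1 : 1 <= K.
Hypothesis G_lip : forall X Y, `|G X - G Y| <= K * `|X - Y|.

Lemma picard_lindelof : exists X : R -> 'M[R]_(m, n), X 0 = X0 /\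
  forall t : R, 0 <= t -> forall i j,
    is_derive t 1 (fun s => X s i j) (G (X t) i j).
Proof.
pose B (t : R) := `|G X0| * expR (2 * K * `|t|).
pose it := picard_iter G X0.
have B0 t : 0 <= B t by rewrite mulr_ge0 ?expR_ge0.
have lim_it (t : R) i j : exists l : R,
    forall k, `|l - it k t i j| <= 2 * B t / 2 ^+ k.
  apply: geometric_dist_limit => k.
  apply: le_trans (picard_iter_dist X0 K1 G_lip k t).
  have := ler_coord_norm (it k.+1 t - it k t) i j.
  by rewrite !mxE.
pose Z (t : R) := \matrix_(i, j) sval (cid (lim_it t i j)).
have hZ t k : `|Z t - it k t| <= 2 * B t / 2 ^+ k.
  apply/mx_norm_leP; first by rewrite divr_ge0 ?exprn_ge0 // mulr_ge0.
  move=> i j; rewrite !mxE; exact: (svalP (cid (lim_it t i j))).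
have cit k : continuous (it k).
  exact: (@continuous_picard_iter _ _ _ _ _ X0 K1 G_lip k).
have cZ : continuous Z.
  move=> t; apply/(@cvgrPdist_le _ _ _ (nbhs t)) => e e0.
  (* [B'] dominates [B] on the unit ball around [t], so a single [k] serves all nearby points and
     continuity passes from [it k] to the limit. *)
  pose B' := `|G X0| * expR (2 * K * (`|t| + 1)).
  have [k kB] := @geometric_small _ (2 * B') (e / 3) (divr_gt0 e0 (ltr0n _ 3)).
  have le_B s : `|t - s| < 1 -> 2 * B s / 2 ^+ k <= e / 3.
    move=> ts; apply: le_trans (ltW kB).
    rewrite ler_pM2r ?invr_gt0 ?exprn_gt0 // ler_pM2l //.
    rewrite /B /B' ler_wpM2l // ler_expR ler_pM2l; last first.
      by rewrite mulr_gt0 // (lt_le_trans _ K1).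
    have := ler_normD t (s - t); rewrite subrKC => h.
    apply: le_trans h _; rewrite lerD2l distrC; exact: ltW.
  near=> s.
  have ts : `|t - s| < 1.
    by near: s; apply/nbhs_ballP; exists 1 => //=.
  have h1 := le_trans (hZ t k) (le_B t _).
  have h2 := le_trans (hZ s k) (le_B s ts).
  have h3 : `|it k t - it k s| <= e / 3.
    near: s; have /(@cvgrPdist_le _ _ _ (nbhs t)) := cit k t.
    by apply; rewrite divr_gt0.
  have -> : Z t - Z s = (Z t - it k t) + (it k t - it k s) - (Z s - it k s).
    by rewrite addrA subrK opprB addrA subrK.
  apply: le_trans (ler_normB _ _) _.
  apply: le_trans (lerD (ler_normD _ _) (lexx _)) _.
  have := h1 _; rewrite subrr normr0 ltr01 => /(_ isT) {}h1.
  lra.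
have solZ (t : R) : 0 <= t -> solve_along G X0 Z t = Z t.
  move=> t0; apply/eqP; rewrite -subr_eq0 -normr_le0 leNgt; apply/negP.
  (* If the two sides differed, some [k] would make [2 * B t / 2 ^+ k] smaller than their distance.
     But both lie within [B t / 2 ^+ k] of iterate [k.+1]. *)
  move=> /(geometric_small (2 * B t))[k]; apply/negP; rewrite -leNgt.
  have h1 := hZ t k.+1.
  have h2 : `|solve_along G X0 Z t - solve_along G X0 (it k) t| <= B t / 2 ^+ k.
    have -> : B t / 2 ^+ k = 2 * `|G X0| / 2 ^+ k / 2 * expR (2 * K * t).
      by rewrite /B ger0_norm //; field; rewrite expf_neq0.
    apply: (solve_along_dist X0 K1 G_lip cZ (cit k)) => //.
    move=> s s0; apply: le_trans (hZ s k) _.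
    by rewrite /B (ger0_norm s0) mulrA mulrAC.
  rewrite -[solve_along _ _ (it k) t]/(solve_along G X0 (it k) t) in h2.
  have itS : it k.+1 t = solve_along G X0 (it k) t by rewrite /it /= ger0_norm.
  rewrite itS in h1.
  have -> : solve_along G X0 Z t - Z t =
      (solve_along G X0 Z t - solve_along G X0 (it k) t)
      - (Z t - solve_along G X0 (it k) t) by rewrite opprB addrA subrK.
  apply: le_trans (ler_normB _ _) _; apply: le_trans (lerD h2 h1) _.
  rewrite exprS le_eqVlt; apply/orP; left; apply/eqP; field.
  by rewrite expf_neq0.
(* [Z] itself would not do: it is even in [t], so in general it has a kink at 0. Its image under the
   integral operator agrees with it for [t >= 0] and has a two-sided derivative at 0. *)
exists (solve_along G X0 Z); split; first exact: solve_along0.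
move=> t t0 i j; rewrite solZ //.
exact: (is_derive_solve_along X0 K1 G_lip).
Unshelve. all: by end_near. Qed.

End picard_solution.

(** Passes from the sup norm, in which Lipschitz bounds are stated, to sums of squares, which can be
    differentiated in the Gronwall arguments. *)
Lemma sqr_coord_le_sum (R : realType) (m n : nat) (X : 'M[R]_(m, n)) :
  `|X| ^+ 2 <= \sum_i \sum_j X i j ^+ 2.
Proof.
have S0 : 0 <= \sum_i \sum_j X i j ^+ 2.
  by apply: sumr_ge0 => i _; apply: sumr_ge0 => j _; exact: sqr_ge0.
rewrite -[leRHS]sqr_sqrtr // ler_sqr ?nnegrE ?sqrtr_ge0 //.
apply/mx_norm_leP; first exact: sqrtr_ge0.
move=> i j; rewrite -sqrtr_sqr ler_sqrt //.
rewrite (bigD1 i) //= (bigD1 j) //= -addrA lerDl.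
apply: addr_ge0; first by apply: sumr_ge0 => ? _; exact: sqr_ge0.
by apply: sumr_ge0 => ? _; apply: sumr_ge0 => ? _; exact: sqr_ge0.
Qed.

Lemma is_derive_sum_fct (R : realType) (I : finType) (f df : I -> R -> R)
    (t : R) :
  (forall i, is_derive t 1 (f i) (df i t)) ->
  is_derive t 1 (fun s => \sum_i f i s) (\sum_i df i t).
Proof.
move=> h; have -> : (fun s => \sum_i f i s) = \sum_i f i.
  by apply/funext => s; rewrite fct_sumE.
elim/big_ind2 : _ => // [|f1 d1 f2 d2 ? ?]; first exact: is_derive_cst.
exact: is_deriveD.
Qed.

Lemma is_derive_sqr_fct (R : realType) (f : R -> R) (df t : R) :
  is_derive t 1 f df -> is_derive t 1 (fun s => f s ^+ 2) (2 * (f t * df)).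
Proof.
move=> h.
have -> : (fun s => f s ^+ 2) = f * f by apply/funext => s; rewrite expr2.
rewrite (_ : 2 * _ = f t *: df + f t *: df); first exact: is_deriveM.
by rewrite /GRing.scale/= mulr_natl mulr2n.
Qed.

(** * Wasserstein distance of empirical measures *)

Section empirical_coupling.
Variables (R : realType) (d n : nat).
Local Notation S := (sphere R d.+1).
Variables x y : 'I_n.+1 -> S.

(** [msum] takes measures indexed by naturals, hence [inord]. In this form the integration rules for
    scaled finite sums of measures apply. *)
Definition matching_coupling : set (S * S) -> \bar R :=
  mscale (n.+1%:R^-1 : R)%:nng
    (msum (fun k => \d_((x (inord k), y (inord k)) : S * S)) n.+1).

HB.instance Definition _ := Measure.on matching_coupling.

Lemma matching_couplingE (A : set (S * S)) :
  matching_coupling A =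
    ((n.+1%:R^-1)%:E * \sum_(k < n.+1) \d_(x k, y k) A)%E.
Proof.
rewrite /matching_coupling /mscale /msum /=.
by congr (_ * _)%E; apply: eq_bigr => k _; rewrite inord_val.
Qed.

Let matching_coupling_setT : matching_coupling setT = 1%E.
Proof.
rewrite matching_couplingE (eq_bigr (fun=> 1%E)) => [|k _]; last exact: diracT.
by rewrite sumEFin sumr_const card_ord -EFinM mulVf.
Qed.

HB.instance Definition _ :=
  Measure_isProbability.Build _ _ _ matching_coupling matching_coupling_setT.

Lemma matching_coupling_is_coupling :
  is_coupling (empirical x) (empirical y) matching_coupling.
Proof.
move=> A mA; split; apply: etrans (matching_couplingE _) _;
  congr (_ * _)%E; apply: eq_bigr => k _;
  by rewrite !diracE in_setX /= in_setT ?andbT.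
Qed.

(** Open intervals generate the Borel sets of the line, and their preimages are open since the
    sphere carries the initial topology of its inclusion. *)
Lemma measurable_sphere_coord (i : 'I_d.+1) :
  measurable_fun setT (fun s : S => sphere_val s i ord0).
Proof.
apply: (measurability _ (RGenOpens.measurableE R)) => _ [_ [a [b ->]] <-].
rewrite setTI; apply: sub_sigma_algebra.
apply: (@open_comp S R (fun s => sphere_val s i ord0)); last first.
  exact: interval_open.
move=> s _.
apply: (@continuous_comp S _ _ (@sphere_val R d.+1) (fun M => M i ord0)).
  exact: initial_continuous.
exact: coord_continuous.
Qed.

(** Pairs carry the product sigma-algebra, so measurability is assembled from the coordinates of the
    two factors instead of being read off from continuity. *)
Lemma measurable_sphere_dist :
  measurable_fun setT
    (fun z : S * S => enorm (sphere_val z.1 - sphere_val z.2)).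
Proof.
rewrite /enorm.
apply: (@measurableT_comp _ _ _ _ _ _ (@Num.sqrt R)).
  exact: continuous_measurable_fun (@sqrt_continuous R).
apply: measurable_sum => i; apply: measurable_funX.
rewrite (_ : (fun _ => _) = (fun z : S * S => sphere_val z.1 i ord0)
    \- (fun z : S * S => sphere_val z.2 i ord0)); last first.
  by apply/funext => z; rewrite !mxE.
apply: measurable_funB.
  exact: measurableT_comp (measurable_sphere_coord i) measurable_fst.
exact: measurableT_comp (measurable_sphere_coord i) measurable_snd.
Qed.

Lemma W1_empirical_le :
  (W1 (empirical x) (empirical y) <=
   (n.+1%:R^-1 * \sum_k enorm (sphere_val (x k) - sphere_val (y k)))%:E)%E.
Proof.
apply: ereal_inf_lbound; exists matching_coupling.
  exact: matching_coupling_is_coupling.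
have mf : measurable_fun setT
    (fun z : S * S => (enorm (sphere_val z.1 - sphere_val z.2))%:E).
  exact: ((measurable_EFinP _ _).2 measurable_sphere_dist).
have f0 (z : S * S) : setT z ->
    (0 <= (enorm (sphere_val z.1 - sphere_val z.2))%:E)%E.
  by rewrite lee_fin sqrtr_ge0.
apply: etrans (ge0_integral_mscale _ _ _ mf f0) _ => //.
rewrite ge0_integral_measure_sum // EFinM -sumEFin.
congr (_ * _)%E; apply: eq_bigr => k _.
by rewrite integral_dirac // diracT mul1e inord_val.
Qed.

End empirical_coupling.

(** * Comparison of the sup, Euclidean and operator norms *)

Section operator_norm.
Variables (R : realType) (d : nat).

Lemma ler_coord_enorm (x : 'cV[R]_d) i : `|x i ord0| <= enorm x.
Proof.
rewrite -sqrtr_sqr ler_sqrt.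
  by rewrite (bigD1 i) //= lerDl; apply: sumr_ge0 => j _; exact: sqr_ge0.
by apply: sumr_ge0 => j _; exact: sqr_ge0.
Qed.

(** The sharp factor is the square root of [d]; the cruder [d] comes from [d <= d ^ 2] and avoids a
    second root. *)
Lemma enorm_le_norm (x : 'cV[R]_d) : enorm x <= d%:R * `|x|.
Proof.
rewrite -[leRHS]ger0_norm; last by rewrite mulr_ge0.
rewrite -sqrtr_sqr ler_sqrt ?sqr_ge0 //.
apply: (@le_trans _ _ (\sum_(i < d) `|x| ^+ 2)).
  apply: ler_sum => i _; rewrite -(real_normK (num_real (x i ord0))).
  by rewrite ler_sqr ?nnegrE // ler_coord_norm.
rewrite sumr_const card_ord exprMn -[leLHS]mulr_natl ler_wpM2r ?sqr_ge0 //.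
by rewrite -natrX ler_nat; case: (d) => // k; rewrite expnS expn1 leq_pmulr.
Qed.

Lemma ler_coord_opnorm (A : 'M[R]_d) i j : `|A i j| <= opnorm A.
Proof.
have enorm_dj : enorm (delta_mx j ord0 : 'cV[R]_d) = 1.
  rewrite /enorm (bigD1 j) //= big1 => [|k /negPf kj].
    by rewrite mxE !eqxx expr1n addr0 sqrtr1.
  by rewrite mxE kj expr0n.
have -> : A i j = (A *m delta_mx j ord0 : 'cV[R]_d) i ord0.
  by rewrite -colE mxE.
apply: le_trans (ler_coord_enorm _ _) _.
apply: ub_le_sup; last first.
  by exists (delta_mx j ord0) => //=; rewrite enorm_dj.
(* [opnorm] is a [sup], which bounds its elements only once the set is known to be bounded above;
   this explicit bound shows that it is. *)
exists (d%:R * \sum_k \sum_l `|A k l|) => _ [x /= x1 <-].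
apply: le_trans (enorm_le_norm _) _; rewrite ler_wpM2l //.
apply/mx_norm_leP; first by do 2 (apply: sumr_ge0 => ? _).
move=> k o; rewrite ord1 mxE.
apply: le_trans (ler_norm_sum _ _ _) _.
rewrite [leRHS](bigD1 k) //=; apply: ler_wpDr.
  by do 2 (apply: sumr_ge0 => ? _).
apply: ler_sum => l _; rewrite normrM ler_piMr //.
exact: le_trans (ler_coord_enorm _ _) x1.
Qed.

End operator_norm.

(** * Globally Lipschitz extension of the vector field *)

Section bounded_lipschitz.
Variables (R : realType) (V : normedModType R).
Implicit Types f g : V -> R.

(** Boundedness is included because it makes the class stable under products, hence under the matrix
    products that form the vector field. *)
Definition bounded_lipschitz f := exists K : R,
  forall X Y, `|f X| <= K /\ `|f X - f Y| <= K * `|X - Y|.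

Lemma bounded_lipschitz_cst (c : R) : bounded_lipschitz (fun=> c).
Proof.
exists `|c| => X Y; split => //.
by rewrite subrr normr0 mulr_ge0.
Qed.

Lemma bounded_lipschitzD f g : bounded_lipschitz f -> bounded_lipschitz g ->
  bounded_lipschitz (fun X => f X + g X).
Proof.
move=> [K hf] [L hg]; exists (K + L) => X Y.
have [f1 f2] := hf X Y; have [g1 g2] := hg X Y; split.
  exact: le_trans (ler_normD _ _) (lerD f1 g1).
by rewrite opprD addrACA mulrDl; exact: le_trans (ler_normD _ _) (lerD f2 g2).
Qed.

Lemma bounded_lipschitzN f : bounded_lipschitz f ->
  bounded_lipschitz (fun X => - f X).
Proof.
move=> [K hf]; exists K => X Y; have [f1 f2] := hf X Y.
rewrite normrN; split => //.
by rewrite -opprD normrN.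
Qed.

Lemma bounded_lipschitzM f g : bounded_lipschitz f -> bounded_lipschitz g ->
  bounded_lipschitz (fun X => f X * g X).
Proof.
move=> [K hf] [L hg]; exists (2 * (K * L)) => X Y.
have [f1 f2] := hf X Y; have [g1 g2] := hg X Y; have [g3 _] := hg Y X.
have K0 : 0 <= K := le_trans (normr_ge0 _) f1.
have L0 : 0 <= L := le_trans (normr_ge0 _) g1.
split.
  rewrite normrM; apply: le_trans (ler_pM _ _ f1 g1) _ => //.
  by rewrite ler_peMl ?mulr_ge0 // ler1n.
have -> : f X * g X - f Y * g Y = f X * (g X - g Y) + (f X - f Y) * g Y by ring.
apply: le_trans (ler_normD _ _) _; rewrite !normrM.
have h1 : `|f X| * `|g X - g Y| <= K * (L * `|X - Y|) by apply: ler_pM.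
have h2 : `|f X - f Y| * `|g Y| <= K * `|X - Y| * L by apply: ler_pM.
apply: le_trans (lerD h1 h2) _.
by rewrite le_eqVlt; apply/orP; left; apply/eqP; ring.
Qed.

Lemma bounded_lipschitz_sum (I : finType) (f : I -> V -> R) :
  (forall i, bounded_lipschitz (f i)) ->
  bounded_lipschitz (fun X => \sum_i f i X).
Proof.
move=> hf; have -> : (fun X => \sum_i f i X) = \sum_i f i.
  by apply/funext => X; rewrite fct_sumE.
elim/big_ind : _ => [|f1 f2 h1 h2|//].
  exact: (bounded_lipschitz_cst 0).
exact: bounded_lipschitzD.
Qed.

Lemma bounded_lipschitz_mulmx (m n p : nat)
    (A : V -> 'M[R]_(m, n)) (B : V -> 'M[R]_(n, p)) :
  (forall i j, bounded_lipschitz (fun X => A X i j)) ->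
  (forall i j, bounded_lipschitz (fun X => B X i j)) ->
  forall i j, bounded_lipschitz (fun X => (A X *m B X) i j).
Proof.
move=> hA hB i j.
rewrite (_ : (fun _ => _) = fun X => \sum_k A X i k * B X k j); last first.
  by apply/funext => X; rewrite mxE.
by apply: bounded_lipschitz_sum => k; exact: bounded_lipschitzM.
Qed.

Lemma bounded_lipschitz_trmx (m n : nat) (A : V -> 'M[R]_(m, n)) :
  (forall i j, bounded_lipschitz (fun X => A X i j)) ->
  forall i j, bounded_lipschitz (fun X => (A X)^T i j).
Proof.
move=> hA i j; rewrite (_ : (fun _ => _) = fun X => A X j i); first exact: hA.
by apply/funext => X; rewrite mxE.
Qed.

Lemma bounded_lipschitz_mx (m n : nat) (G : V -> 'M[R]_(m, n)) :
  (forall i j, bounded_lipschitz (fun X => G X i j)) ->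
  exists2 K : R, 1 <= K & forall X Y, `|G X - G Y| <= K * `|X - Y|.
Proof.
move=> hG; pose k i j := sval (cid (hG i j)).
have hk i j X Y : `|G X i j - G Y i j| <= k i j * `|X - Y|.
  exact: (svalP (cid (hG i j)) X Y).2.
have k0 i j : 0 <= k i j.
  exact: le_trans (normr_ge0 _) (svalP (cid (hG i j)) 0 0).1.
have S0 : 0 <= \sum_i \sum_j k i j by do 2 (apply: sumr_ge0 => ? _).
(* The added 1 provides the lower bound on the constant that Picard iteration asks for. *)
exists (1 + \sum_i \sum_j k i j) => [|X Y]; first by rewrite lerDl.
apply/mx_norm_leP => [|i j]; first by rewrite mulr_ge0 // addr_ge0.
rewrite !mxE; apply: le_trans (hk i j X Y) _; rewrite ler_wpM2r //.
apply: ler_wpDl => //; rewrite (bigD1 i) //= (bigD1 j) //= -addrA lerDl.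
by apply: addr_ge0; do ?(apply: sumr_ge0 => ? _).
Qed.

(** The extension is the infimum over [s] of the [K]-Lipschitz functions [f s + K * |X - iota s|].
    The point [t0] makes the set nonempty and [lbE] bounds it below, so the infimum is genuine. *)
Lemma mcshane_extension (T : Type) (t0 : T) (iota : T -> V) (f : T -> R)
    (K : R) : 0 <= K ->
  (forall s t, `|f s - f t| <= K * `|iota s - iota t|) ->
  exists2 g : V -> R, forall X Y, `|g X - g Y| <= K * `|X - Y| &
    forall s, g (iota s) = f s.
Proof.
move=> K0 hf.
pose E X := range (fun s => f s + K * `|X - iota s|).
have E0 X : E X !=set0 by exists (f t0 + K * `|X - iota t0|), t0.
have lbE X t : lbound (E X) (f t - K * `|X - iota t|).
  move=> _ [s _ <-].
  have h1 := hf t s.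
  have h2 : `|iota t - iota s| <= `|X - iota t| + `|X - iota s|.
    by rewrite (distrC X (iota t)); exact: ler_distD.
  have h3 := ler_wpM2l K0 h2; rewrite mulrDr in h3.
  by move/ler_normlP : h1 => [_ h1]; lra.
have hlb X : has_lbound (E X) by exists (f t0 - K * `|X - iota t0|).
pose g X := inf (E X).
have g_le X s : g X <= f s + K * `|X - iota s|.
  by apply: ge_inf => //; exists s.
have gXY X Y : g X <= g Y + K * `|X - Y|.
  rewrite -lerBlDr; apply: lb_le_inf => // _ [s _ <-].
  rewrite lerBlDr; apply: le_trans (g_le X s) _.
  rewrite -addrA lerD2l -mulrDr ler_wpM2l // [leRHS]addrC; exact: ler_distD.
exists g => [X Y|s].
  have h1 := gXY X Y; have h2 := gXY Y X; rewrite distrC in h2.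
  by apply/ler_normlP; split; lra.
apply/eqP; rewrite eq_le; apply/andP; split.
  by have := g_le (iota s) s; rewrite subrr normr0 mulr0 addr0.
apply: lb_le_inf => //.
by have := lbE (iota s) s; rewrite subrr normr0 mulr0 subr0.
Qed.

End bounded_lipschitz.

(** * Radial clipping of the rows of a matrix *)

Section clip.
Variables (R : realType) (m n : nat).
Implicit Types X Y : 'M[R]_(m, n).

Definition row_scale X k : R := Num.max 1 `|row k X|.

(* Rescaling each row radially keeps it collinear to the original one, which
   is what preserves the tangency of the vector field. *)
Definition clip X : 'M[R]_(m, n) := \matrix_(k, i) (X k i / row_scale X k).

Lemma row_scale_ge1 X k : 1 <= row_scale X k.
Proof. by rewrite le_max lexx. Qed.

Lemma ler_norm_row X k : `|row k X| <= `|X|.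
Proof. by apply/mx_norm_leP => // i j; rewrite mxE ler_coord_norm. Qed.

Lemma ler_coord_row_scale X k i : `|X k i| <= row_scale X k.
Proof.
rewrite le_max; apply/orP; right.
by have := ler_coord_norm (row k X) ord0 i; rewrite mxE.
Qed.

Lemma row_scale_dist X Y k : `|row_scale X k - row_scale Y k| <= `|X - Y|.
Proof.
have : `|row k X - row k Y| <= `|X - Y| by rewrite -linearB ler_norm_row.
apply: le_trans; apply: le_trans (ler_dist_dist _ _).
rewrite /row_scale; have := normr_ge0 (row k X); have := normr_ge0 (row k Y).
move: `|row k X| `|row k Y| => a b _ _.
case: (leP 1 a) => ha; case: (leP 1 b) => hb; first by [];
  rewrite ?subrr ?normr0 //; apply/ler_normlP; split;
  have := ler_norm (a - b); have := lerNnormlW (lexx `|a - b|); lra.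
Qed.

Lemma norm_clip_le1 X k i : `|clip X k i| <= 1.
Proof.
have S1 := row_scale_ge1 X k; have S0 := lt_le_trans ltr01 S1.
rewrite mxE normrM normfV (gtr0_norm S0) ler_pdivrMr // mul1r.
exact: ler_coord_row_scale.
Qed.

Lemma bounded_lipschitz_clip k i : bounded_lipschitz (fun X => clip X k i).
Proof.
exists 2 => X Y; split.
  by rewrite (le_trans (norm_clip_le1 _ _ _)) // ler1n.
have M1 := row_scale_ge1 X k; have N1 := row_scale_ge1 Y k.
have M0 := lt_le_trans ltr01 M1; have N0 := lt_le_trans ltr01 N1.
(* The difference of quotients is arranged so that the only remaining quotient in the bracket is a
   clipped entry, at most 1 in size. Both terms are then at most [|X - Y|], whence the constant
   2. *)
have -> : clip X k i - clip Y k i = (row_scale X k)^-1 *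
    ((X k i - Y k i) - clip Y k i * (row_scale X k - row_scale Y k)).
  by rewrite !mxE; field; rewrite !gt_eqF.
rewrite normrM gtr0_norm ?invr_gt0 //.
apply: le_trans (ler_piMl (normr_ge0 _) _) _; first by rewrite invf_le1.
apply: le_trans (ler_normB _ _) _; rewrite normrM.
have h1 : `|X k i - Y k i| <= `|X - Y|.
  by have := ler_coord_norm (X - Y) k i; rewrite !mxE.
have h2 : `|clip Y k i| * `|row_scale X k - row_scale Y k| <= 1 * `|X - Y|.
  by apply: ler_pM => //; [exact: norm_clip_le1|exact: row_scale_dist].
by apply: le_trans (lerD h1 h2) _; rewrite mul1r mulr_natl mulr2n.
Qed.

Lemma bounded_lipschitz_clip_row k o p :
  bounded_lipschitz (fun X => (row k (clip X))^T o p).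
Proof.
apply: bounded_lipschitz_trmx => {}o {}p.
rewrite (_ : (fun _ => _) = fun X => clip X k p).
  exact: bounded_lipschitz_clip.
by apply/funext => X; rewrite mxE.
Qed.

Lemma clip_id X : (forall k i, `|X k i| <= 1) -> clip X = X.
Proof.
move=> X1; apply/matrixP => k i; rewrite mxE /row_scale max_l ?divr1 //.
by apply/mx_norm_leP => // o j; rewrite mxE.
Qed.

End clip.

(** For [u] the squared Euclidean length of a row and [M] its [row_scale], the left side is the
    scalar factor of the radial component of the clipped field. Clipping thus does not enlarge the
    defect from the sphere. *)
Lemma le_clip_defect (R : realType) (u M : R) : 1 <= M ->
  (M = 1 \/ M ^+ 2 <= u) -> `|M * (1 - u / M ^+ 2)| <= `|u - 1|.
Proof.
move=> M1 [->|Mu]; first by rewrite expr1n divr1 mul1r distrC.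
have M0 : 0 < M := lt_le_trans ltr01 M1.
pose s := u / M ^+ 2.
have us : u = s * M ^+ 2 by rewrite /s divfK // expf_neq0 // gt_eqF.
have s1 : 1 <= s by rewrite /s ler_pdivlMr ?mul1r // exprn_gt0.
rewrite -/s us ler0_norm; last by rewrite pmulr_rle0 // subr_le0.
apply: le_trans (ler_norm _).
rewrite -subr_ge0.
have -> : s * M ^+ 2 - 1 - - (M * (1 - s)) = (M - 1) * (s * M + 1) by ring.
apply: mulr_ge0; first by rewrite subr_ge0.
by rewrite addr_ge0 // mulr_ge0 ?(ltW M0) // (le_trans ler01).
Qed.

Definition tangent_field (R : realType) (d : nat) (A : 'M[R]_d)
    (y : 'cV[R]_d) : 'cV[R]_d :=
  (1%:M - y *m y^T) *m A *m y.

(** Off the sphere the projector is no longer exact, but [y^T (1 - y y^T) = (1 - |y|^2) y^T] still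
    holds. *)
Lemma tangent_field_radial (R : realType) (d : nat) (A : 'M[R]_d)
    (y : 'cV[R]_d) :
  (y^T *m tangent_field A y) ord0 ord0 =
    (1 - \sum_i y i ord0 ^+ 2) * (y^T *m A *m y) ord0 ord0.
Proof.
have yy : y^T *m y = (\sum_i y i ord0 ^+ 2)%:M.
  rewrite [LHS]mx11_scalar mxE; congr (_%:M).
  by apply: eq_bigr => i _; rewrite mxE expr2.
rewrite /tangent_field !mulmxA mulmxBr mulmx1 mulmxA yy mul_scalar_mx.
set s := \sum_i _.
have -> : y^T - s *: y^T = (1 - s) *: y^T by rewrite scalerBl scale1r.
by rewrite -!scalemxAl mxE.
Qed.

Section clipped_field.
Variables (R : realType) (m n : nat) (A : 'M[R]_(m, n) -> 'M[R]_n).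
Hypothesis bl_A : forall i j, bounded_lipschitz (fun X => A X i j).

Definition clipped_field (X : 'M[R]_(m, n)) : 'M[R]_(m, n) :=
  \matrix_(k, i) tangent_field (A X) (row k (clip X))^T i ord0.

Lemma bounded_lipschitz_clipped_field k i :
  bounded_lipschitz (fun X => clipped_field X k i).
Proof.
have bl_y := @bounded_lipschitz_clip_row R m n k.
rewrite (_ : (fun _ => _) = fun X =>
    tangent_field (A X) (row k (clip X))^T i ord0); last first.
  by apply/funext => X; rewrite mxE.
apply: bounded_lipschitz_mulmx => // {}i j.
apply: bounded_lipschitz_mulmx => // {}i {}j.
rewrite (_ : (fun _ => _) = fun X : 'M[R]_(m, n) => (i == j)%:R +
    - ((row k (clip X))^T *m ((row k (clip X))^T)^T) i j); last first.
  by apply/funext => X; rewrite !mxE.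
apply: bounded_lipschitzD; first exact: bounded_lipschitz_cst.
apply/bounded_lipschitzN/bounded_lipschitz_mulmx => //.
exact: bounded_lipschitz_trmx.
Qed.

(** Row [k] of [X] is [M] times its clipped version, so its product with the field is
    [M * (1 - u / M ^+ 2)] times the quadratic form [q k], which is bounded. *)
Lemma clipped_field_radial : exists C : R, forall (X : 'M[R]_(m, n)) k,
  `|\sum_i X k i * clipped_field X k i| <= C * `|\sum_i X k i ^+ 2 - 1|.
Proof.
pose q k (X : 'M[R]_(m, n)) :=
  ((row k (clip X))^T^T *m A X *m (row k (clip X))^T) ord0 ord0.
have bl_q k : bounded_lipschitz (q k).
  have bl_y := @bounded_lipschitz_clip_row R m n k.
  apply: bounded_lipschitz_mulmx => //.
  by apply: bounded_lipschitz_mulmx => //; exact: bounded_lipschitz_trmx.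
pose c k := sval (cid (bl_q k)).
have qc k X : `|q k X| <= c k by exact: (svalP (cid (bl_q k)) X X).1.
exists (\sum_k c k) => X k.
have ck : c k <= \sum_k c k.
  rewrite (bigD1 k) //= lerDl; apply: sumr_ge0 => o _.
  exact: le_trans (normr_ge0 _) (qc o X).
set u := \sum_i X k i ^+ 2; set M := row_scale X k.
have M1 : 1 <= M := row_scale_ge1 X k.
have M0 : 0 < M := lt_le_trans ltr01 M1.
have -> : \sum_i X k i * clipped_field X k i = M * (1 - u / M ^+ 2) * q k X.
  rewrite -mulrA; have -> : u / M ^+ 2 = \sum_i (row k (clip X))^T i ord0 ^+ 2.
    by rewrite mulr_suml; apply: eq_bigr => i _; rewrite !mxE -exprVn -exprMn.
  rewrite -tangent_field_radial mxE mulr_sumr; apply: eq_bigr => i _.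
  rewrite mulrA; congr (_ * _); last by rewrite mxE.
  by rewrite !mxE -/M mulrC divfK // gt_eqF.
(* When the maximum is not 1, [M] is the sup norm of the row, which is at most its Euclidean
   norm. *)
have Mu : M = 1 \/ M ^+ 2 <= u.
  rewrite /M /row_scale; case: (leP 1 `|row k X|) => _; [right|by left].
  apply: le_trans (sqr_coord_le_sum _) _; rewrite big_ord1.
  by rewrite le_eqVlt; apply/orP; left; apply/eqP/eq_bigr => i _; rewrite mxE.
rewrite normrM mulrC; apply: ler_pM => //.
  exact: le_trans (qc k X) ck.
exact: le_clip_defect.
Qed.

End clipped_field.

(** * Invariance of the sphere and uniqueness *)

Section derivative_of_curves.
Variable R : realType.

Lemma is_derive_mxP (m n : nat) (X : R -> 'M[R]_(m, n)) (t : R)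
    (dX : 'M[R]_(m, n)) :
  is_derive t 1 X dX <-> forall i j, is_derive t 1 (fun s => X s i j) (dX i j).
Proof.
split=> [[h <-] i j|h].
  split; first exact: (derivable_mxP _ _ _).1.
  by rewrite derive_mx // mxE.
have dX_ : derivable X t 1.
  by apply/derivable_mxP => i j; have [] := h i j.
split => //; rewrite derive_mx //; apply/matrixP => i j; rewrite mxE.
exact: derive_val.
Qed.

Lemma is_deriv_ge0_coord (d : nat) (f f' : R -> 'cV[R]_d) (t : R) i :
  is_deriv_ge0 f f' -> 0 < t ->
  is_derive t 1 (fun s => f s i ord0) (f' t i ord0) /\
  {within `[0, t], continuous (fun s => f s i ord0)}.
Proof.
move=> [df df0] t0.
have dfi (s : R) : 0 < s -> is_derive s 1 (fun s => f s i ord0) (f' s i ord0).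
  by move=> /df /is_derive_mxP; exact.
have cfi (s : R) : 0 < s -> {for s, continuous (fun s => f s i ord0)}.
  move=> s0; apply: differentiable_continuous; apply/derivable1_diffP.
  by have [] := dfi s s0.
split; first exact: dfi.
apply/continuous_within_itvP => //; split.
- by move=> s; rewrite in_itv/= => /andP[s0 _]; exact: cfi.
- have quot : ((h : R)^-1 *: (f h - f 0)) i ord0 @[h --> 0^'+] --> f' 0 i ord0.
    apply: (cvg_comp _ (fun M : 'cV[R]_d => M i ord0) df0).
    exact: coord_continuous.
  (* Right continuity at 0 follows from the one-sided derivative, as [f h] equals [f 0] plus [h]
     times the difference quotient. *)
  have lin : h * ((h : R)^-1 *: (f h - f 0)) i ord0 + f 0 i ord0 @[h --> 0^'+]
      --> 0 * f' 0 i ord0 + f 0 i ord0.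
    apply: cvgD; last exact: cvg_cst.
    by apply: cvgM => //; apply: cvg_at_right_filter; exact: cvg_id.
  rewrite mul0r add0r in lin; apply: cvg_trans lin; apply: near_eq_cvg.
  near=> h; rewrite !mxE mulrA divff ?mul1r ?subrK //.
- by apply: cvg_at_left_filter; exact: cfi.
Unshelve. all: by end_near. Qed.

(** Meant for a curve [f] with arbitrary values at negative times: the two-sided derivative at 0 is
    taken on [g], and only its right limit is transferred to [f]. *)
Lemma is_derive_is_deriv_ge0 (V : normedModType R) (f g f' : R -> V) :
  (forall t : R, 0 <= t -> f t = g t) ->
  (forall t : R, 0 <= t -> is_derive t 1 g (f' t)) -> is_deriv_ge0 f f'.
Proof.
move=> fg dg; split => [t t0|].
  apply: near_eq_is_derive (dg t (ltW t0)).
  near=> s; rewrite fg //; apply: ltW; near: s; exact: lt_nbhsr.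
have [dg0 <-] := dg 0 (lexx _).
have /cvg_dnbhs_at_right := dg0; apply: cvg_trans; apply: near_eq_cvg.
near=> h; rewrite /= addr0 [h *: _]mulr1 !fg //.
Unshelve. all: by end_near. Qed.

End derivative_of_curves.

Lemma lipschitz_flow_unique (R : realType) (m n : nat)
    (G : 'M[R]_(m, n) -> 'M[R]_(m, n)) (K : R) (X Y : R -> 'M[R]_(m, n)) :
  0 <= K -> (forall X Y, `|G X - G Y| <= K * `|X - Y|) ->
  (forall (t : R) i j, 0 < t ->
    is_derive t 1 (fun s => X s i j) (G (X t) i j) /\
    {within `[0, t], continuous (fun s => X s i j)}) ->
  (forall (t : R) i j, 0 < t ->
    is_derive t 1 (fun s => Y s i j) (G (Y t) i j) /\
    {within `[0, t], continuous (fun s => Y s i j)}) ->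
  X 0 = Y 0 -> forall t : R, 0 <= t -> X t = Y t.
Proof.
move=> K0 G_lip hX hY XY0 t; rewrite le_eqVlt => /predU1P[<- //|t0].
pose e (i : 'I_m) (j : 'I_n) (s : R) := X s i j - Y s i j.
pose de (i : 'I_m) (j : 'I_n) (s : R) := G (X s) i j - G (Y s) i j.
pose phi s := \sum_i \sum_j e i j s ^+ 2.
pose dphi s := \sum_i \sum_j 2 * (e i j s * de i j s).
have He (s : R) i j : 0 < s -> is_derive s 1 (e i j) (de i j s).
  move=> s0; have [h1 _] := hX s i j s0; have [h2 _] := hY s i j s0.
  exact: is_deriveB.
have Ce i j : {within `[0, t], continuous (e i j)}.
  move=> s; have [_ h1] := hX t i j t0; have [_ h2] := hY t i j t0.
  exact: (continuousD (h1 s) (continuousN (h2 s))).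
have norm_le s : `|X s - Y s| ^+ 2 <= phi s.
  apply: le_trans (sqr_coord_le_sum _) _; rewrite le_eqVlt; apply/orP; left.
  by apply/eqP; do 2 (apply: eq_bigr => ? _); rewrite !mxE.
suff : phi t <= 0.
  move=> h; apply/eqP; rewrite -subr_eq0 -normr_eq0 -sqrf_eq0.
  rewrite eq_le sqr_ge0 andbT.
  exact: le_trans (norm_le t) h.
(* Each of the [m * n] terms of [dphi] is at most [2 * K] times the squared sup norm of [X s - Y s],
   hence at most [2 * K * phi s]. *)
apply: (@gronwall0 R phi dphi (2 * K * (m * n)%:R)) (ltW t0) _ _ _ _.
- move=> s s0; apply: (is_derive_sum_fct
    (df := fun i s => \sum_j 2 * (e i j s * de i j s))) => i.
  apply: (is_derive_sum_fct (df := fun j s => 2 * (e i j s * de i j s))) => j.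
  exact/is_derive_sqr_fct/He.
- have -> : phi = \sum_i \sum_j (e i j * e i j).
    apply/funext => s; rewrite fct_sumE; apply: eq_bigr => i _.
    by rewrite fct_sumE.
  pose cont (f : R -> R) := {within `[0, t], continuous f}.
  have cont0 : cont 0 by apply: continuous_subspaceT => s; exact: cvg_cst.
  have contD f g : cont f -> cont g -> cont (f + g).
    by move=> cf cg s; exact: continuousD (cf s) (cg s).
  apply: (big_ind cont) => // i _; apply: (big_ind cont) => // j _ s.
  exact: continuousM (Ce i j s) (Ce i j s).
- move=> s s0; apply: (@le_trans _ _ (\sum_(i < m) \sum_(j < n) 2 * K * phi s)).
    apply: ler_sum => i _; apply: ler_sum => j _; rewrite -mulrA ler_pM2l //.
    apply: le_trans (ler_norm _) _; rewrite normrM.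
    apply: (@le_trans _ _ (`|X s - Y s| * (K * `|X s - Y s|))).
      apply: ler_pM => //.
        by have := ler_coord_norm (X s - Y s) i j; rewrite !mxE.
      apply: le_trans (G_lip _ _).
      by have := ler_coord_norm (G (X s) - G (Y s)) i j; rewrite !mxE.
    by rewrite mulrCA -expr2 ler_wpM2l.
  rewrite !sumr_const !card_ord -mulrnA mulnC -mulr_natr le_eqVlt.
  by apply/orP; left; apply/eqP; ring.
- rewrite /phi big1 // => i _; rewrite big1 // => j _.
  by rewrite /e XY0 subrr expr0n.
Qed.

Lemma clipped_flow_sphere (R : realType) (m n : nat)
    (A : 'M[R]_(m, n) -> 'M[R]_n) (X : R -> 'M[R]_(m, n)) :
  (forall i j, bounded_lipschitz (fun X => A X i j)) ->
  (forall t : R, 0 <= t -> forall i j,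
    is_derive t 1 (fun s => X s i j) (clipped_field A (X t) i j)) ->
  (forall k, \sum_i X 0 k i ^+ 2 = 1) ->
  forall (t : R) k, 0 <= t -> \sum_i X t k i ^+ 2 = 1.
Proof.
move=> bl_A hX X01 t k t0.
have [C hC] := clipped_field_radial bl_A.
pose u (s : R) := \sum_i X s k i ^+ 2 - 1.
pose du (s : R) := \sum_i 2 * (X s k i * clipped_field A (X s) k i).
have Hu (s : R) : 0 <= s -> is_derive s 1 u (du s).
  move=> s0; rewrite -[du s]subr0; apply: is_deriveB.
  apply: (is_derive_sum_fct
    (df := fun i s => 2 * (X s k i * clipped_field A (X s) k i))) => i.
  exact/is_derive_sqr_fct/hX.
have Hphi (s : R) : 0 <= s ->
    is_derive s 1 (fun s => u s ^+ 2) (2 * (u s * du s)).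
  by move=> s0; exact/is_derive_sqr_fct/Hu.
suff : u t ^+ 2 <= 0.
  move=> h; apply/eqP; rewrite -subr_eq0 -sqrf_eq0 eq_le sqr_ge0 andbT.
  exact: h.
(* [|du|] is at most [2 * C * |u|], so the derivative of the square is at most [4 * C] times the
   square. Squaring turns the one-sided Gronwall bound into [u = 0]. *)
apply: (@gronwall0 R (fun s => u s ^+ 2) (fun s => 2 * (u s * du s))
  (4 * C)) => //.
- by move=> s /ltW; exact: Hphi.
- apply: derivable_within_continuous => s; rewrite in_itv/= => /andP[s0 _].
  by have [] := Hphi s s0.
- move=> s s0; apply: le_trans (ler_norm _) _.
  rewrite /du -mulr_sumr !normrM ger0_norm //.
  have -> : 4 * C * u s ^+ 2 = 2 * (`|u s| * (2 * (C * `|u s|))).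
    by rewrite -(real_normK (num_real (u s))); ring.
  by do 2 (rewrite ler_pM2l //; try apply: ler_wpM2l => //); exact: hC.
- by rewrite /u X01 subrr expr0n.
Qed.

(** * Interacting particles on the sphere *)

Section configurations.
Variables (R : realType) (d n : nat).
Local Notation S := (sphere R d.+1).
Implicit Types x y : 'I_n.+1 -> S.

Definition config x : 'M[R]_(n.+1, d.+1) :=
  \matrix_(k, i) sphere_val (x k) i ord0.

Lemma sphere_sum_sqr (s : S) : \sum_i sphere_val s i ord0 ^+ 2 = 1.
Proof.
have /eqP := sphere_valP s; rewrite /enorm => h.
rewrite -[LHS]sqr_sqrtr ?h ?expr1n //.
by apply: sumr_ge0 => i _; exact: sqr_ge0.
Qed.

Lemma clip_config x : clip (config x) = config x.
Proof.
apply: clip_id => k i; rewrite mxE; apply: le_trans (ler_coord_enorm _ _) _.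
by rewrite (eqP (sphere_valP _)).
Qed.

Lemma clipped_field_config (A : 'M[R]_(n.+1, d.+1) -> 'M[R]_d.+1) x k i :
  clipped_field A (config x) k i =
  tangent_field (A (config x)) (sphere_val (x k)) i ord0.
Proof.
rewrite mxE clip_config; congr (tangent_field _ _ _ _).
by apply/colP => j; rewrite !mxE.
Qed.

Variable F : probability S R -> 'M[R]_d.+1.
Variable L : R.
Hypothesis L0 : 0 <= L.
Hypothesis F_lip : forall mu nu : probability S R,
  ((opnorm (F mu - F nu))%:E <= L%:E * W1 mu nu)%E.

Lemma empirical_coord_lipschitz x y i j :
  `|F (empirical x) i j - F (empirical y) i j|
    <= L * d.+1%:R * `|config x - config y|.
Proof.
have := ler_coord_opnorm (F (empirical x) - F (empirical y)) i j.
rewrite !mxE => h; apply: le_trans h _; rewrite -mulrA -lee_fin.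
apply: le_trans (F_lip _ _) _; rewrite EFinM lee_wpmul2l ?lee_fin //.
apply: le_trans (W1_empirical_le x y) _; rewrite lee_fin.
rewrite ler_pdivrMl //.
apply: (@le_trans _ _ (\sum_(k < n.+1) d.+1%:R * `|config x - config y|)).
  apply: ler_sum => k _; apply: le_trans (enorm_le_norm _) _.
  rewrite ler_pM2l //; apply/mx_norm_leP => // a b.
  by have := ler_coord_norm (config x - config y) k a; rewrite ord1 !mxE.
by rewrite sumr_const card_ord -[leLHS]mulr_natl.
Qed.

(** A McShane extension is Lipschitz but may be unbounded. Composing it with [clip] bounds it and
    changes nothing on configurations, which [clip] fixes. *)
Lemma empirical_extension (x0 : 'I_n.+1 -> S) :
  exists2 A : 'M[R]_(n.+1, d.+1) -> 'M[R]_d.+1,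
    forall i j, bounded_lipschitz (fun X => A X i j) &
    forall x, A (config x) = F (empirical x).
Proof.
pose K := L * d.+1%:R.
have K0 : 0 <= K by rewrite mulr_ge0.
have ext i j := mcshane_extension x0 K0
  (fun x y => empirical_coord_lipschitz x y i j).
pose g i j := s2val (cid2 (ext i j)).
have g_lip i j : forall X Y, `|g i j X - g i j Y| <= K * `|X - Y|.
  exact: s2valP (cid2 (ext i j)).
have gE i j : forall x, g i j (config x) = F (empirical x) i j.
  exact: s2valP' (cid2 (ext i j)).
exists (fun X => \matrix_(i, j) g i j (clip X)) => [i j|x]; last first.
  by apply/matrixP => i j; rewrite mxE clip_config gE.
have [C C1 clip_lip] :=
  bounded_lipschitz_mx (@bounded_lipschitz_clip R n.+1 d.+1).
have C0 : 0 <= C := le_trans ler01 C1.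
exists (`|g i j 0| + K * C) => X Y; rewrite !mxE; split.
  rewrite -[g i j (clip X)](subrK (g i j 0)) addrC.
  apply: le_trans (ler_normD _ _) _; rewrite lerD2l.
  apply: le_trans (g_lip i j _ _) _; rewrite subr0 ler_wpM2l //.
  apply: le_trans C1; apply/mx_norm_leP => // k l; exact: norm_clip_le1.
apply: le_trans (g_lip i j _ _) _.
rewrite mulrDl; apply: ler_wpDl; first by rewrite mulr_ge0.
by rewrite -mulrA ler_wpM2l.
Qed.

End configurations.

Theorem theorem2p3 (R : realType) (d : nat)
    (F : probability (sphere R d.+1) R -> 'M[R]_d.+1)
    (F_Lipschitz : exists2 L : R, 0 <= L &
       forall mu nu : probability (sphere R d.+1) R,
         ((opnorm (F mu - F nu))%:E <= L%:E * W1 mu nu)%E)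
    (n : nat) (x0 : 'I_n.+1 -> sphere R d.+1) :
  exists x : 'I_n.+1 -> R -> sphere R d.+1,
    is_global_solution F x0 x /\
    forall y : 'I_n.+1 -> R -> sphere R d.+1,
      is_global_solution F x0 y -> 
        forall (k : 'I_n.+1) (t : R), 0 <= t -> y k t = x k t.
Proof.
have [L L0 F_lip] := F_Lipschitz.
have [A bl_A AE] := empirical_extension L0 F_lip x0.
pose G := clipped_field A.
have [K K1 G_lip] :=
  bounded_lipschitz_mx (bounded_lipschitz_clipped_field bl_A).
have GE (x : 'I_n.+1 -> sphere R d.+1) k i : G (config x) k i =
    tangent_field (F (empirical x)) (sphere_val (x k)) i ord0.
  by rewrite /G clipped_field_config AE.
have [X [X0 dX]] := picard_lindelof (config x0) K1 G_lip.
have X_sphere (t : R) k : 0 <= t -> enorm (row k (X t))^T == 1.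
  move=> t0; rewrite /enorm (eq_bigr (fun i => X t k i ^+ 2)); last first.
    by move=> i _; rewrite !mxE.
  rewrite (clipped_flow_sphere bl_A dX) ?sqrtr1 // => l.
  rewrite X0 -(sphere_sum_sqr (x0 l)); apply: eq_bigr => i _.
  by rewrite mxE.
(* The default [x0 k] can occur only at negative times, where [X t] may leave the sphere. *)
pose x k (t : R) : sphere R d.+1 := insubd (x0 k) (row k (X t))^T.
have xE k (t : R) : 0 <= t -> sphere_val (x k t) = (row k (X t))^T.
  by move=> t0; exact: (insubdK (x0 k) (X_sphere t k t0)).
have config_x (t : R) : 0 <= t -> config (x^~ t) = X t.
  by move=> t0; apply/matrixP => k i; rewrite mxE xE // !mxE.
have fieldE k (t : R) : 0 <= t ->
    tangent_field (F (empirical (x^~ t))) (sphere_val (x k t)) =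
    (row k (G (X t)))^T.
  by move=> t0; apply/colP => i; rewrite -(GE (x^~ t)) config_x // !mxE.
have sol_x k : is_deriv_ge0 (fun t => sphere_val (x k t))
    (fun t => tangent_field (F (empirical (x^~ t))) (sphere_val (x k t))).
  apply: (is_derive_is_deriv_ge0 (g := fun t => (row k (X t))^T)).
    by move=> t; exact: xE.
  move=> t t0; rewrite fieldE //; apply/is_derive_mxP => i j.
  have := dX t t0 k i; rewrite !mxE.
  by congr is_derive; apply/funext => s; rewrite !mxE.
have X_cont (t : R) : 0 <= t -> {for t, continuous X}.
  move=> t0; apply: continuous_mx => i j.
  apply: differentiable_continuous; apply/derivable1_diffP.
  by have [] := dX t t0 i j.
have x_init k : x k 0 = x0 k.
  apply: val_inj; rewrite /= xE // X0; apply/colP => i; by rewrite !mxE.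
have sol : is_global_solution F x0 x.
  split => // k.
  exists (fun t =>
    tangent_field (F (empirical (x^~ t))) (sphere_val (x k t))) => //.
  (* On [[0, +oo[] the velocity equals a row of [G (X t)], a composition of continuous maps. *)
  apply: (@subspace_eq_continuous _ _ _ (fun t => (row k (G (X t)))^T)).
    by move=> t; rewrite inE /= in_itv/= andbT => t0; exact/esym/fieldE.
  apply: continuous_in_subspaceT => t; rewrite inE /= in_itv/= andbT => t0.
  apply: continuous_mx => i j.
  rewrite (_ : (fun _ => _) =
    (fun M : 'M[R]_(n.+1, d.+1) => M k i) \o (G \o X)); last first.
    by apply/funext => s; rewrite /= !mxE.
  apply: continuous_comp; last exact: coord_continuous.
  apply: continuous_comp; first exact: X_cont.
  exact: (lipschitz_mx_continuous K1 G_lip).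
(* Every solution of the original system also solves the extended Lipschitz one, so uniqueness there
   suffices. *)
have flow_of (y : 'I_n.+1 -> R -> sphere R d.+1) : is_global_solution F x0 y ->
    forall (t : R) k i, 0 < t ->
    is_derive t 1 (fun s => config (y^~ s) k i) (G (config (y^~ t)) k i) /\
    {within `[0, t], continuous (fun s => config (y^~ s) k i)}.
  move=> [_ _ sol_y] t k i t0.
  have := is_deriv_ge0_coord i (sol_y k) t0.
  rewrite (_ : (fun s => config (y^~ s) k i) =
      (fun s => sphere_val (y k s) i ord0)).
    by rewrite GE.
  by apply/funext => s; rewrite mxE.
exists x; split => // y sol_y k t t0.
have K0 : 0 <= K := le_trans ler01 K1.
have : config (y^~ t) = config (x^~ t).
  apply: (lipschitz_flow_unique K0 G_lip (flow_of y sol_y)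
    (flow_of x sol)) => //.
  case: sol_y => _ y_init _; apply/matrixP => l i.
  by rewrite !mxE y_init x_init.
move=> /matrixP e; apply: val_inj; apply/colP => i.
by have := e k i; rewrite !mxE.
Qed.
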